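(* Let $n \in \{1,2\}$, let $\mathbb{T}$ be a time scale with forward jump operator $\sigma$, let $a, t_1, \ldots, t_n \in \mathbb{T}$ with $t_i > a$ for $i = 1, \ldots, n$, and let $f$ be an integrable function on $\mathbb{T}$. Then $$\int_{a}^{t_n} \cdots \int_{a}^{t_1} f(t_0)\, \Delta t_0 \cdots \Delta t_{n-1} = \frac{1}{(n-1)!}\int_{a}^{t_n} (t_n -\sigma(s))^{n-1} f(s)\, \Delta s.$$ Explicitly, for $n=1$ the left-hand side is $\int_a^{t_1} f(t_0)\,\Delta t_0$, and for $n=2$ the left-hand side is $\int_a^{t_2}\left(\int_a^{t_1} f(t_0)\,\Delta t_0\right)\Delta t_1$.
   Context: A time scale $\mathbb{T}$ is an arbitrary nonempty closed subset of $\mathbb{R}$. The forward jump operator is $\sigma(t) := \inf\{s \in \mathbb{T} : s > t\}$, with the convention $\sigma(t) = t$ if $t = \max \mathbb{T}$. Functions are real-valued, and $\int_a^t f(s)\,\Delta s$ denotes the usual delta integral of time-scale calculus; ''integrable'' means integrable with respect to the delta integral. It is the integral inverse to the delta derivative $f^\Delta$; for example, it is the ordinary integral when $\mathbb{T}=\mathbb{R}$ and $\int_a^t f(s)\,\Delta s=\sum_{s=a}^{t-1} f(s)$ when $\mathbb{T}=\mathbb{Z}$ and $t>a$. On the left-hand side of the formula the symbols $t_0,\ldots,t_{n-1}$ are the integration variables (over $\mathbb{T}$), and only $a$ and $t_n$ are free. The factor $(t_n-\sigma(s))^{n-1}$ is identically $1$ when $n=1$. *)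

(* Defs.v *)
From HB Require Import structures.
From mathcomp Require Import all_boot all_order all_algebra.
From mathcomp Require Import all_classical all_reals all_analysis.

Set Implicit Arguments.
Unset Strict Implicit.
Unset Printing Implicit Defensive.

Import Order.TTheory GRing.Theory Num.Theory.
Import numFieldNormedType.Exports.

Local Open Scope classical_set_scope.
Local Open Scope ring_scope.

Record timeScale (R : realType) := TimeScale {
  ts_set :> R -> Prop;
  ts_neq0 : ts_set !=set0;
  ts_closed : closed ts_set
}.

Section time_scale.
Context {R : realType}.
Implicit Types (T : timeScale R) (a b : R) (f : R -> R).

(* [inf set0 = 0] in the library, hence the case distinction; a point of [T]
   without a larger point in [T] is the maximum of [T]. *)
Definition fjump T (t : R) : R :=
  if pselect (exists2 s, T s & t < s)
  then inf [set s | T s /\ t < s] else t.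

Definition ts_itv T a b : set R := [set x | T x /\ a <= x < b].

Definition delta_cover T (X : set R) : set (nat -> R * R) :=
  [set p | (forall k, [/\ T (p k).1, T (p k).2
                        & (p k).1 <= (p k).2]) /\
           X `<=` \bigcup_k ts_itv T (p k).1 (p k).2].

(* The outer measure generated by giving [a, b) the length b - a; it is +oo on
   sets without a countable cover, e.g. on those containing max T. *)
Definition delta_outer T (X : set R) : \bar R :=
  ereal_inf [set (\sum_(0 <= k <oo) ((p k).2 - (p k).1)%:E)%E
            | p in delta_cover T X].

Let delta_cover_ge0 T X p : delta_cover T X p ->
  forall k, (0%E <= ((p k).2 - (p k).1)%:E)%E.
Proof. by move=> [h _] k; rewrite lee_fin subr_ge0; case: (h k). Qed.

Lemma delta_outer_ge0 T X : (0 <= delta_outer T X)%E.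
Proof.
apply: le_ereal_inf_tmp => _ [p pX <-]; apply: nneseries_ge0 => k _ _.
exact: delta_cover_ge0 pX k.
Qed.

Lemma le_delta_outer T :
  {homo delta_outer T : A B / A `<=` B >-> (A <= B)%E}.
Proof.
move=> A B AB; apply: ereal_inf_le_tmp => _ [p [h pB] <-]; exists p => //.
by split=> //; exact: subset_trans pB.
Qed.

Lemma delta_outer0 T : delta_outer T set0 = 0%E.
Proof.
apply/eqP; rewrite eq_le delta_outer_ge0 andbT; have [x Tx] := ts_neq0 T.
apply: ereal_inf_lbound; exists (fun=> (x, x)) => /=.
  by split=> [k|y //]; split.
by rewrite eseries0// => k _ _; rewrite subrr.
Qed.

Lemma delta_outer_sigma_subadditive T : sigma_subadditive (delta_outer T).
Proof.
move=> A; have [[i ioo]|] := pselect (exists i, delta_outer T (A i) = +oo%E).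
  rewrite (eseries_pinfty _ _ ioo) ?leey// => n _.
  by rewrite -ltNye (lt_le_trans _ (delta_outer_ge0 _ _)).
rewrite -forallNE => Aoo; apply/lee_addgt0Pr => e e0.
rewrite (le_trans _ (epsilon_trick _ _ (ltW e0)))//; last first.
  by move=> n; exact: delta_outer_ge0.
pose P n (p : nat -> R * R) := delta_cover T (A n) p /\
  (\sum_(k <oo) ((p k).2 - (p k).1)%:E <=
     delta_outer T (A n) + (e / (2 ^ n.+1)%:R)%:E)%E.
have [G PG] : {G : nat -> nat -> R * R & forall n, P n (G n)}.
  apply: (@choice _ _ P) => n.
  have en1 : 0 < e / (2 ^ n.+1)%:R by rewrite divr_gt0// ltr0n expn_gt0.
  have /(lb_ereal_inf_adherent en1) : delta_outer T (A n) \is a fin_num.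
    by rewrite ge0_fin_numE ?delta_outer_ge0// ltey; apply/eqP/Aoo.
  by move=> [x [p pA <-] xS]; exists p; split => //; exact/ltW.
pose l (i : nat * nat) : \bar R := ((G i.1 i.2).2 - (G i.1 i.2).1)%:E.
have l0 i : (0 <= l i)%E by exact: delta_cover_ge0 (PG i.1).1 i.2.
have /card_esym/ppcard_eqP[h] := card_nat2.
apply: (@le_trans _ _ (\esum_(i in setT) l i)%E).
  apply: ereal_inf_lbound => /=; exists (uncurry G \o h).
    split=> [k /=|].
      by rewrite /uncurry; case: (h k) => i j; exact: (PG i).1.1 j.
    move=> t [i _ /(PG i).1.2 [j _ ?]]; exists (h^-1%FUN (i, j)) => //=.
    by rewrite invK ?inE.
  rewrite (@eq_eseriesr _ _ (l \o h)); last first.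
    by move=> k _; rewrite /l/= /uncurry; case: (h k).
  rewrite nneseries_esumT; last by move=> k; exact: l0.
  by rewrite (reindex_esum setT setT h)//; exact: bij.
have -> : (\esum_(i in setT) l i)%E = (\sum_(i <oo) \sum_(j <oo) l (i, j))%E.
  rewrite nneseries_esumT; last by move=> i; exact: nneseries_ge0.
  rewrite (@eq_esum _ _ _ _ (fun i => \esum_(j in setT) l (i, j))%E); last first.
    by move=> i _; rewrite (nneseries_esumT (a := fun j => l (i, j))).
  rewrite (esum_esum (a := fun i j => l (i, j)))//.
  by congr esum; apply/seteqP; split.
apply: lee_nneseries => [i _|i _]; first by move=> _; exact: nneseries_ge0.
exact: (PG i).2.
Qed.

HB.instance Definition _ T := isOuterMeasure.Build R R (delta_outer T)
  (delta_outer0 T) (delta_outer_ge0 T) (@le_delta_outer T)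
  (@delta_outer_sigma_subadditive T).

(* The Lebesgue delta-measure (Guseinov), on the Caratheodory sigma-algebra. *)
Definition delta_measure T : set (caratheodory_type (delta_outer T)) -> \bar R :=
  delta_outer T.

Arguments delta_measure T _ : clear implicits.

HB.instance Definition _ T := isMeasure.Build _ _ _ (delta_measure T)
  (@caratheodory_measure0 _ _ (delta_outer T))
  (@caratheodory_measure_ge0 _ _ (delta_outer T))
  (@caratheodory_measure_sigma_additive _ _ (delta_outer T)).

Lemma caratheodory_ts T : (delta_outer T).-caratheodory T.
Proof.
apply: le_caratheodory_measurable => X.
have [XT|/existsNP[x /not_implyP[Xx nTx]]] := pselect (X `<=` ts_set T).
  have -> : X `&` ~` ts_set T = set0 by rewrite -subset0 => x [/XT].
  by rewrite outer_measure0 adde0 le_outer_measure.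
suff XE : delta_outer T X = +oo%E by rewrite [leRHS]XE leey.
rewrite /delta_outer (_ : delta_cover T X = set0) ?image_set0 ?ereal_inf0//.
by rewrite -subset0 => p [_ /(_ _ Xx)[k _ []]].
Qed.

Lemma caratheodory_ray T c : T c ->
  (delta_outer T).-caratheodory [set x | c <= x].
Proof.
move=> Tc; apply: le_caratheodory_measurable => X.
apply: le_ereal_inf_tmp => _ [p [Tp pX] <-].
pose m k := Num.min (p k).2 (Num.max (p k).1 c).
have Tm k : T (m k).
  by have [? ? _] := Tp k; rewrite /m; case: leP => // _; case: leP.
have m1 k : (p k).1 <= m k.
  by have [_ _ h] := Tp k; rewrite /m le_min h le_max lexx.
have m2 k : m k <= (p k).2 by rewrite /m ge_min lexx.
have -> : (\sum_(k <oo) ((p k).2 - (p k).1)%:E =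
    \sum_(k <oo) ((p k).2 - m k)%:E + \sum_(k <oo) (m k - (p k).1)%:E)%E.
  rewrite -nneseriesD; last 2 first.
  - by move=> k _; rewrite lee_fin subr_ge0.
  - by move=> k _; rewrite lee_fin subr_ge0.
  by apply: eq_eseriesr => k _; rewrite -EFinD addrA subrK.
apply: leeD; apply: ereal_inf_lbound.
- exists (fun k => (m k, (p k).2)) => //; split => [k|x [/pX[k _ [Tx xk]] /= cx]].
    by have [? ? _] := Tp k; split => /=.
  exists k => //; split => //=; case/andP: xk => x1 ->.
  by rewrite /m ge_min ge_max x1 cx orbT.
- exists (fun k => ((p k).1, m k)) => //.
  split => [k|x [/pX[k _ [Tx xk]] /= /negP cx]]; first by have [? ? _] := Tp k; split => /=.
  exists k => //; split => //=; case/andP: xk => -> x2.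
  by rewrite /m lt_min lt_max x2 (ltNge x c) cx orbT.
Qed.

Lemma measurable_ts_itv T a b : T a -> T b ->
  (delta_outer T).-cara.-measurable (ts_itv T a b).
Proof.
move=> Ta Tb; have -> : ts_itv T a b =
    ts_set T `&` ([set x | a <= x] `\` [set x | b <= x]).
  apply/seteqP; split=> x /=.
    by move=> [Tx /andP[ax xb]]; split => //; split => //; apply/negP; rewrite -ltNge.
  by move=> [Tx [ax /negP xb]]; split; rewrite // ax/= ltNge.
apply: caratheodory_measurable_setI; first exact: caratheodory_ts.
by apply: caratheodory_measurable_setD; exact: caratheodory_ray.
Qed.

Lemma delta_measure_itv T a b : T a -> T b -> a <= b ->
  delta_measure T (ts_itv T a b) = (b - a)%:E.
Proof.
move=> Ta Tb ab; apply/eqP; rewrite eq_le; apply/andP; split.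
  apply: ereal_inf_lbound; exists (fun k => if k is 0%N then (a, b) else (a, a)).
    by split=> [[|k]|x abx]; [split|split|exists 0%N].
  rewrite nneseries_recl//=; last by move=> [|k] _; rewrite lee_fin subr_ge0.
  by rewrite eseries0 ?adde0// => -[|k]//= _ _; rewrite subrr.
apply: le_ereal_inf_tmp => _ [p [Tp pab] <-].
have lebE x y : x <= y -> ((y - x)%:E = @lebesgue_measure R `[x, y[%classic)%E.
  rewrite le_eqVlt => /predU1P[->|xy]; first by rewrite set_itvco0// measure0 subrr.
  by rewrite lebesgue_measure_itv/= lte_fin xy EFinB.
rewrite lebE// (eq_eseriesr (g := fun k =>
  @lebesgue_measure R `[(p k).1, (p k).2[%classic)); last first.
  by move=> k _; rewrite lebE//; have [] := Tp k.
apply: (@measure_sigma_subadditive _ _ _ (@lebesgue_measure R) `[a, b[%classic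
    (fun k => `[(p k).1, (p k).2[%classic)).
- by move=> k; exact: measurable_itv.
- exact: measurable_itv.
move=> x /=; rewrite in_itv/= => /andP[ax xb].
(* the largest point of T below x *)
pose S := ts_set T `&` [set y | y <= x].
have Sa : S a by split.
have hS : has_sup S by split; [exists a|exists x => y []].
have Ssup : S (sup S).
  have cS : closed S by apply: closedI; [exact: ts_closed|exact: closed_le].
  by apply: cS; apply: closure_sup => //; [exists a|exact: hS.2].
have [/= Tsx sx] := Ssup.
have as' : a <= sup S by apply: ub_le_sup => //; exact: hS.2.
have [|k _ [_ /andP[k1 k2]]] := pab (sup S).
  by split => //; rewrite as' (le_lt_trans sx).
exists k => //=; rewrite in_itv/= (le_trans k1 sx)/= ltNge; apply/negP => kx.
suff : (p k).2 <= sup S by rewrite leNgt k2.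
by apply: ub_le_sup; [exact: hS.2|split => //; have [] := Tp k].
Qed.

Definition delta_integrable T a b f :=
  (delta_measure T).-integrable (ts_itv T a b) (EFin \o f).

(* The constants are delta-integrable in this sense on every time scale, also on
   the unbounded ones; the definition involves f on T only. *)
Definition locally_delta_integrable T f :=
  forall a b, T a -> T b -> a <= b -> delta_integrable T a b f.

Definition delta_int T f a b : R :=
  if a <= b then \int[delta_measure T]_(s in ts_itv T a b) f s
  else - \int[delta_measure T]_(s in ts_itv T b a) f s.

(* k-fold repeated integral, as a function of its outermost upper limit. *)
Fixpoint iter_delta_int T f a (k : nat) : R -> R :=
  if k is k'.+1 then fun t => delta_int T (iter_delta_int T f a k') a t
  else f.

End time_scale.
Arguments delta_measure {R} T _.

(* Main.v *)
(* For n = 2, Fubini's theorem on the triangle {(s, x) | a <= s < x < b} turns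
   the iterated integral into the integral of f(s) times the delta-measure of
   {x in T | s < x < b}. That measure is b - sigma(s): the set lies in
   [sigma(s), b) and contains [y, b) for every y > s in T, and such y come
   arbitrarily close to sigma(s). *)

Require Import Defs.
From mathcomp Require Import all_boot all_order all_algebra.
From mathcomp Require Import all_classical all_reals all_analysis.
From mathcomp Require Import measurable_realfun lra.

Set Implicit Arguments.
Unset Strict Implicit.
Unset Printing Implicit Defensive.

Import Order.TTheory GRing.Theory Num.Theory.
Import numFieldNormedType.Exports.

Local Open Scope classical_set_scope.
Local Open Scope ring_scope.

(** * Integration against a measure restricted to a set of finite measure *)

Section mfrestr_integral.
Local Open Scope ereal_scope.
Context d (X : measurableType d) (R : realType) (mu : {measure set X -> \bar R}).
Context (D : set X) (mD : measurable D) (Dfin : mu D < +oo).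

Lemma integral_mfrestr (g : X -> \bar R) :
  \int[mfrestr mD Dfin]_(x in D) g x = \int[mu]_(x in D) g x.
Proof.
apply: eq_measure_integral => A mA AD.
by rewrite /= /mfrestr /mrestr setIidl.
Qed.

(** Measurability of [g] does not depend on the measure, and the integrals of [|g|] over [D] agree
    because the restriction coincides with [mu] on measurable subsets of [D]. *)
Lemma integrable_mfrestr (g : X -> \bar R) :
  (mfrestr mD Dfin).-integrable setT (g \_ D) <-> mu.-integrable D g.
Proof.
have int_abs : \int[mfrestr mD Dfin]_(x in D) `|g x| = \int[mu]_(x in D) `|g x|.
  exact: integral_mfrestr.
by rewrite -integrable_mkcond//; split=> /integrableP[mg gfin];
  apply/integrableP; rewrite ?int_abs// -?int_abs.
Qed.

End mfrestr_integral.

(** * Fubini's theorem for a function of the first variable cut off by a measurable set *)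

Section fubini_section.
Context d (X : measurableType d) (R : realType) (mu : {measure set X -> \bar R}).
Context (D : set X) (mD : measurable D) (Dfin : (mu D < +oo)%E).
Context (f : X -> R) (intf : mu.-integrable D (EFin \o f)).
Context (E : set (X * X)) (mE : measurable E).

(* Fubini's theorem needs sigma-finiteness, which [mu] may lack. *)
Let nu := mfrestr mD Dfin.

Let fD : X -> R := f \_ D.

(** Integrating out the second variable weighs [f] by the measure of a section of [E]; integrating
    out the first gives integrals of [f] over sections. *)
Let h (z : X * X) : \bar R := (fD z.1 * \1_E z)%:E.

Let intfD : nu.-integrable setT (EFin \o fD).
Proof. by rewrite /fD -restrict_EFin; apply/integrable_mfrestr. Qed.

Let mfD : measurable_fun setT fD.
Proof. by move/measurable_int: intfD => /measurable_EFinP. Qed.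

(** [h] is [g] times an indicator bounded by 1. Since [g] depends on [z.1] alone, the iterated
    integral of its absolute value is the integral of [|fD|] times the finite total mass of [nu]. *)
Let inth : (nu \x nu)%E.-integrable setT h.
Proof.
pose g (z : X * X) : \bar R := (fD z.1)%:E.
have mg : measurable_fun setT g.
  by apply/measurable_EFinP; apply: measurableT_comp.
have intg : (nu \x nu)%E.-integrable setT g.
  apply/(integrable12ltyP _ _ mg).
  under eq_integral do rewrite /g /= integral_cst//.
  case/integrableP: (integrableZr measurableT (fine (nu setT)) intfD) => _.
  congr (_ < _)%E; apply: eq_integral => x _ /=.
  by rewrite normrM (ger0_norm (fine_ge0 _))// EFinM fineK ?fin_num_measure.
have -> : h = (g \* (EFin \o \1_E))%E by apply/funext => z.
apply: integrableMl => //; exists 1; split => // M M1 z _ /=.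
by rewrite indicE; case: (_ \in _); rewrite ?normr1 ?normr0 ltW// (lt_trans ltr01).
Qed.

Let int_xsection : fubini_F nu h =
  (EFin \o (fun s => f s * fine (mu (xsection E s `&` D)))) \_ D.
Proof.
apply/funext => s; rewrite /fubini_F /h /=.
under eq_integral do rewrite EFinM.
rewrite integralZl//; last first.
  apply: eq_integrable (integrable_indic nu (measurable_xsection s mE)) => // x _.
  by rewrite !indicE mem_xsection.
under eq_integral => x _ do rewrite indicE -mem_xsection -indicE.
rewrite integral_indic// ?setIT; last exact: measurable_xsection.
rewrite patchE /fD patchE; case: ifPn => // _ /=; last by rewrite mul0e.
rewrite EFinM fineK//.
(* The [nu]-measure of the section is finite, and it is by definition the [mu]-measure of its trace
   on [D]. *)
have := fin_num_measure nu _ (measurable_xsection s mE).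
exact.
Qed.

Let int_ysection : fubini_G nu h =
  (fun x => \int[mu]_(s in ysection E x `&` D) (f s)%:E)%E.
Proof.
apply/funext => x; rewrite /fubini_G integral_mkcondl.
rewrite -(integral_mfrestr mD Dfin) [RHS]integral_mkcond.
apply: eq_integral => s _; rewrite /h /fD /= indicE -mem_ysection !patchE.
by case: (s \in D); case: (s \in ysection E x); rewrite ?mulr1 ?mulr0 ?mul0r.
Qed.

Let int_ysection_fin x :
  ((\int[mu]_(s in ysection E x `&` D) f s)%R%:E =
   \int[mu]_(s in ysection E x `&` D) (f s)%:E)%E.
Proof.
rewrite fineK//; apply: integrable_fin_num.
  by apply: measurableI => //; exact: measurable_ysection.
apply: integrableS intf => //.
by apply: measurableI => //; exact: measurable_ysection.
Qed.

Lemma integrable_xsection :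
  mu.-integrable D (EFin \o (fun s => f s * fine (mu (xsection E s `&` D)))).
Proof.
by apply/(integrable_mfrestr mD Dfin); rewrite -int_xsection; exact: integrable_fubini_F.
Qed.

(** The inner integral of [h] is bounded in absolute value by that of [|h|], whose outer integral is
    finite because [h] is integrable on the product. *)
Let integrable_fubini_G : nu.-integrable setT (fubini_G nu h).
Proof.
have mh := measurable_int _ inth.
have mG := measurable_fubini_G inth.
apply/integrableP; split => //.
apply: le_lt_trans ((integrable21ltyP _ _ mh).1 inth).
have mabs := measurableT_comp (@abse_measurable R setT) mh.
apply: ge0_le_integral => //.
- exact: measurableT_comp.
- exact: (measurable_fun_fubini_tonelli_G (m1 := nu) (abse \o h) mabs
    (fun z => abse_ge0 (h z))).
- move=> x _; apply: le_abse_integral => //.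
  exact: measurableT_comp.
Qed.

Lemma integrable_ysection :
  mu.-integrable D
    (EFin \o (fun x => \int[mu]_(s in ysection E x `&` D) f s)).
Proof.
have -> : EFin \o (fun x => \int[mu]_(s in ysection E x `&` D) f s) =
    fubini_G nu h.
  by rewrite int_ysection; apply/funext => x; rewrite /= int_ysection_fin.
apply/(integrable_mfrestr mD Dfin)/(integrable_mkcond _ mD).
exact: integrableS integrable_fubini_G.
Qed.

Lemma Rintegral_xsection_ysection :
  \int[mu]_(x in D) \int[mu]_(s in ysection E x `&` D) f s =
  \int[mu]_(s in D) (f s * fine (mu (xsection E s `&` D))).
Proof.
rewrite /Rintegral; congr fine.
under eq_integral do rewrite int_ysection_fin.
rewrite -[RHS](integral_mfrestr mD Dfin) [RHS]integral_mkcond -int_xsection.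
rewrite /fubini_F (Fubini inth) -/(fubini_G nu h).
rewrite -[LHS](integral_mfrestr mD Dfin) -int_ysection.
(* Unlike [fubini_F nu h], the function [fubini_G nu h] need not vanish off [D]; but [nu] has no
   mass there. *)
have nuD : nu (~` D) = 0%E by rewrite /nu /mfrestr /mrestr setICl measure0.
have := negligible_integral (measurableC mD) measurableT integrable_fubini_G nuD.
by rewrite setDE setTI setCK => ->.
Qed.
End fubini_section.

(** * Measurability of the order on [T], and the double delta integral *)

Section iterated_delta_integral.
Context (R : realType) (T : timeScale R).
Implicit Types (a b c s x : R).

Lemma has_inf_ray (S : set R) c x : S x -> S `<=` [set y | c <= y] -> has_inf S.
Proof. by move=> Sx Sc; split; [exists x | exists c => y /Sc]. Qed.

Lemma closure_inf (S : set R) : has_inf S -> closure S (inf S).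
Proof.
move=> infS B /nbhs_ballP[e /= e0 eB].
have [y Sy ye] := inf_adherent e0 infS.
have infy : inf S <= y by apply: ge_inf => //; exact: infS.2.
exists y; split => //; apply: eB.
by rewrite /ball/= ler0_norm ?subr_le0// opprB ltrBlDl.
Qed.

Lemma ts_inf (S : set R) : S `<=` ts_set T -> has_inf S -> T (inf S).
Proof.
by move=> ST infS; apply/ts_closed/(closureS ST)/closure_inf.
Qed.

(** Here [c] may lie outside [T], as rational cuts do. The part of [T] above [c], if nonempty,
    starts at its infimum, which is in [T] because [T] is closed. *)
Lemma measurable_ts_ray c :
  (delta_outer T).-cara.-measurable (ts_set T `&` [set x | c <= x]).
Proof.
set S := _ `&` _.
have [->|/set0P[x Sx]] := eqVneq S set0; first exact: measurable0.
have infS : has_inf S by apply: (@has_inf_ray _ c x) => // y [].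
have -> : S = ts_set T `&` [set x | inf S <= x].
  apply/seteqP; split=> y [Ty /= cy]; split => //=.
    by apply: ge_inf; [exact: infS.2|split].
  by apply: le_trans cy; apply: lb_le_inf; [exists x|move=> z []].
apply: caratheodory_measurable_setI; first exact: caratheodory_ts.
by apply: caratheodory_ray; apply: ts_inf infS => y [].
Qed.

Let X := caratheodory_type (delta_outer T).

(** Cutting its sections with [ts_itv T a b] yields the slices of the triangle. *)
Definition ts_ltn : set (X * X) := [set z | [/\ T z.1, T z.2 & (z.1 : R) < z.2]].

Lemma measurable_ts_ltn : measurable ts_ltn.
Proof.
(* s < x iff s < q <= x for some rational q *)
pose lo (q : rat) : set X := ts_set T `\` (ts_set T `&` [set x | ratr q <= x]).
pose hi (q : rat) : set X := ts_set T `&` [set x | ratr q <= x].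
have -> : ts_ltn = \bigcup_q (lo q `*` hi q).
  apply/seteqP; split=> [[s x] /= [Ts Tx]|[s x] [q _ [/= [Ts Nqs] [Tx qx]]]].
    move=> /rat_in_itvoo[q]; rewrite in_itv/= => /andP[sq qx].
    exists q => //; split; split => //=; last exact: ltW.
    by move=> [_ /=]; rewrite leNgt sq.
  split => //=; apply: lt_le_trans qx; rewrite ltNge; apply/negP => qs.
  exact: Nqs.
apply: bigcupT_measurable_rat => q; apply: measurableX.
  by apply: measurableD; [exact: caratheodory_ts|exact: measurable_ts_ray].
exact: measurable_ts_ray.
Qed.

Lemma delta_measure_gt s b : T s -> T b -> s < b ->
  delta_measure T [set x | T x /\ s < x < b] = (b - fjump T s)%:E.
Proof.
move=> Ts Tb sb.
rewrite /fjump; case: (pselect _) => [h|[]]; last by exists b.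
pose S := [set y | T y /\ s < y]; pose c := inf S; rewrite -/S -/c.
have infS : has_inf S.
  by apply: (@has_inf_ray _ s b) => // y [_ /ltW].
have Tc : T c by apply: ts_inf infS => y [].
have cb : c <= b by apply: ge_inf => //; exact: infS.2.
apply/eqP; rewrite eq_le; apply/andP; split.
  rewrite -(delta_measure_itv Tc Tb cb); apply: le_outer_measure => x [Tx /andP[sx xb]].
  by split => //; rewrite xb andbT; apply: ge_inf; [exact: infS.2|split].
(* If [c = s], the set does not contain [c], so [c] is approximated by points [y > s] of [T]. *)
apply/lee_addgt0Pr => e e0.
have [y [Ty sy]] := inf_adherent e0 infS; rewrite -/c => yc.
(* If [y] overshoots [b], then [b - c] is already below [e]. *)
have [yb|/ltW by0] := leP y b; last first.
  apply: (@le_trans _ _ e%:E); first by rewrite lee_fin; lra.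
  by rewrite leeDr//; exact: outer_measure_ge0.
apply: (@le_trans _ _ ((b - y)%:E + e%:E)%E); first by rewrite -EFinD lee_fin; lra.
rewrite -(delta_measure_itv Ty Tb yb) leeD2r//.
apply: le_outer_measure => x [Tx /andP[yx xb]].
by split => //; rewrite xb andbT (lt_le_trans sy).
Qed.

Lemma double_delta_int a b f : T a -> T b -> a <= b -> delta_integrable T a b f ->
  [/\ delta_integrable T a b (delta_int T f a),
      delta_integrable T a b (fun s => (b - fjump T s) * f s) &
      delta_int T (delta_int T f a) a b =
      delta_int T (fun s => (b - fjump T s) * f s) a b].
Proof.
move=> Ta Tb ab intf.
pose D : set X := ts_itv T a b.
have mD : measurable D by exact: measurable_ts_itv.
have Dfin : (delta_measure T D < +oo)%E by rewrite delta_measure_itv// ltry.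
have mE := measurable_ts_ltn.
(* The points of [D] below [x] fill [ts_itv T a x], and [a <= x] selects the first branch of
   [delta_int]. *)
have yE x : x \in D ->
    \int[delta_measure T]_(s in ysection ts_ltn x `&` D) f s = delta_int T f a x.
  rewrite inE => -[Tx /andP[ax xb]]; rewrite /delta_int ax; congr Rintegral.
  apply/seteqP; split=> s; rewrite /ysection/=.
    by rewrite inE => -[[/= Ts _ sx] [_ /andP[a_s _]]]; split => //; rewrite a_s.
  move=> [Ts /andP[a_s sx]]; split; first by rewrite inE.
  by split => //; rewrite a_s (lt_trans sx).
(* Points of [D] are strictly below [b], as [delta_measure_gt] requires. *)
have xE s : s \in D -> f s * fine (delta_measure T (xsection ts_ltn s `&` D)) =
    (b - fjump T s) * f s.
  rewrite inE => -[Ts /andP[a_s sb]]; rewrite mulrC.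
  suff -> : xsection ts_ltn s `&` D = [set x | T x /\ s < x < b].
    by rewrite delta_measure_gt.
  apply/seteqP; split=> x; rewrite /xsection/=.
    by rewrite inE => -[[/= _ Tx sx] [_ /andP[_ xb]]]; split => //; rewrite sx.
  move=> [Tx /andP[sx xb]]; split; first by rewrite inE.
  by split => //; rewrite xb andbT (le_trans a_s)// ltW.
split.
- apply: eq_integrable (integrable_ysection mD Dfin intf mE) => // x xD.
  by rewrite /= yE.
- apply: eq_integrable (integrable_xsection mD Dfin intf mE) => // s sD.
  by rewrite /= xE.
- rewrite /delta_int ab -/(delta_int _ _ _ _).
  have := Rintegral_xsection_ysection mD Dfin intf mE.
  under eq_Rintegral do rewrite yE//.
  move=> ->.
  by apply: eq_Rintegral => s sD; rewrite xE.
Qed.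

End iterated_delta_integral.

Theorem theorem2 (R : realType) (T : timeScale R) (n : nat)
    (hn : n = 1%N \/ n = 2%N)
    (a : R) (ha : T a)
    (t : nat -> R) (ht : forall i : nat, (1 <= i <= n)%N -> T (t i) /\ a < t i)
    (f : R -> R) (hf : locally_delta_integrable T f) :
  (forall k : nat, (k < n)%N ->
     delta_integrable T a (t n) (iter_delta_int T f a k)) /\
  delta_integrable T a (t n) (fun s => (t n - fjump T s) ^+ n.-1 * f s) /\
  iter_delta_int T f a n (t n) =
    (n.-1`!)%:R^-1 *
    delta_int T (fun s => (t n - fjump T s) ^+ n.-1 * f s) a (t n).
Proof.
have [Tn /ltW an] : T (t n) /\ a < t n.
  by apply: ht; case: hn => ->.
have intf := hf _ _ ha Tn an.
case: hn => nE; rewrite nE/= in Tn an intf *.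
  have -> : (fun s => (t 1%N - fjump T s) ^+ 0 * f s) = f.
    by apply/funext => s; rewrite expr0 mul1r.
  by split=> [[|//]|]; rewrite ?fact0 ?invr1 ?mul1r.
(* In the remaining case [n = 2] the exponent and the factorial are both 1. *)
have [intF intG eqFG] := double_delta_int ha Tn an intf.
rewrite factS fact0 invr1 mul1r; split; first by move=> [|[|]].
by under eq_fun do rewrite expr1.
Qed.
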